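(* Let $S$ be a semigroup with finitely many $\mathscr L$-classes, $L_1,\ldots,L_k$, where $k\geq1$. Then \[ \mathrm{Ht}(\mathrm{LCong}(S)) = \sum_{r=1}^k \mathrm{Ht}(\mathrm{Cong}({}^S\overline{L}_r)) - k. \]
   Context: The height $\mathrm{Ht}(P)$ of a poset $P$ is the supremum of the cardinalities of chains in $P$ (for infinite heights, sums are cardinal sums, and subtracting a finite number from an infinite cardinal leaves it unchanged). For a semigroup $S$, $S^1$ is $S$ if $S$ is a monoid and otherwise $S$ with an identity adjoined; Green's relation $\mathscr L$ is defined by $x\mathrel{\mathscr L}y\Leftrightarrow S^1x=S^1y$. A left congruence of $S$ is an equivalence relation $\sigma$ on $S$ such that $(x,y)\in\sigma$ implies $(ax,ay)\in\sigma$ for all $a\in S$; $\mathrm{LCong}(S)$ is the lattice of left congruences. A left $S$-act is a set $A$ with maps $a\mapsto s\cdot a$ ($s\in S$) satisfying $s\cdot(s'\cdot a)=(ss')\cdot a$; a congruence of $A$ is an equivalence relation $\sigma$ on $A$ such that $(a,b)\in\sigma$ implies $(s\cdot a,s\cdot b)\in\sigma$ for all $s\in S$, and $\mathrm{Cong}(A)$ is the lattice of congruences of $A$. For an $\mathscr L$-class $L$ of $S$, ${}^S\overline L$ is the left $S$-act with underlying set $\overline L=L\cup\{0\}$ (where $0\notin S$ is a new symbol) and action $s\cdot x=sx$ if $x\in L$ and $sx\in L$, and $s\cdot x=0$ otherwise. *)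

(* Defs.v *)
From HB Require Import structures.
From mathcomp Require Import all_boot all_order.
From mathcomp Require Import all_classical.

Set Implicit Arguments.
Unset Strict Implicit.
Unset Printing Implicit Defensive.

Import Order.TTheory.

Local Open Scope classical_set_scope.
Local Open Scope card_scope.

(* The cardinals are well-ordered: any nonempty family of sets (living in *)
(* possibly different types) has a member that injects into all the others. *)
(* Zorn's lemma is applied to the subsets of the product that are injective *)
(* in each coordinate. *)
Lemma card_le_least (I : Type) (i0 : I) (U : I -> Type)
    (K : forall i, set (U i)) :
  exists i, forall j, K i #<= K j.
Proof.
pose P (Z : set (forall i, U i)) :=
  (forall z, Z z -> forall i, K i (z i)) /\
  (forall z z' i, Z z -> Z z' -> z i = z' i -> z = z').
have [|Z [[ZK Zinj] Zmax]] := @Zorn_bigcup _ P.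
  move=> F FP Ftot; split=> [z [X FX Xz] i|z z' i [X FX Xz] [Y FY Yz'] zz'].
    exact: (FP _ FX).1.
  have [XY|YX] := Ftot _ _ FX FY.
    by apply: ((FP _ FY).2 z z' i) => //; exact: XY.
  by apply: ((FP _ FX).2 z z' i) => //; exact: YX.
have [i iP] : exists i, forall x, K i x -> exists2 z, Z z & z i = x.
  apply: contrapT => /forallNP noi.
  have /(_ _)/cid wit : forall i, exists x : U i,
      K i x /\ forall z, Z z -> z i <> x.
    move=> i; apply: contrapT => /forallNP ni; apply: (noi i) => x Kx.
    apply: contrapT => nz; apply: (ni x); split=> // z Zz zx.
    by apply: nz; exists z.
  pose w i := projT1 (wit i); have wP i := projT2 (wit i).
  apply: (Zmax (Z `|` [set w])).
    split; first by move=> z Zz; left.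
    by move=> /(_ w (or_intror erefl)) /(wP i0).2; apply.
  split=> [z [/ZK //|-> i]|z z' i [Zz|->] [Zz'|->] //].
  - exact: (wP i).1.
  - exact: Zinj.
  - by move=> /((wP i).2 _ Zz).
  - by move=> /esym /((wP i).2 _ Zz').
exists i => j; apply/card_leP/injfunPex.
have /choice[f fP] : forall x : set_type (K i), exists y : set_type (K j),
    exists z, [/\ Z z, z i = val x & z j = val y].
  move=> x; have [z Zz zx] := iP _ (set_valP x).
  by exists (SigSub (mem_set (ZK _ Zz j))), z.
exists f => // x y _ _ fxy; apply: val_inj.
have [z [Zz zx zfx]] := fP x; have [z' [Zz' zy zfy]] := fP y.
by rewrite -zx -zy; congr (_ i); apply: (Zinj _ _ j) => //; rewrite zfx zfy fxy.
Qed.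

Lemma card_le_or (T U : Type) (A : set T) (B : set U) : A #<= B \/ B #<= A.
Proof.
pose V (b : bool) : Type := if b then T else U.
pose K (b : bool) : set (V b) := if b return set (V b) then A else B.
by have [[] KP] := card_le_least true K;
  [left; exact: KP false|right; exact: KP true].
Qed.

Section Height.
Context (d : Order.disp_t) (T : porderType d).
Implicit Types P C H : set T.

Definition chain_in P C := C `<=` P /\ total_on C (fun x y => (x <= y)%O).

(* A subset P of T is viewed as a poset under the order of T. Cardinals are *)
(* represented by sets up to equipotence: H is the least upper bound of the *)
(* cardinals of the chains of P, among sets of elements of arbitrary types. *)
Definition is_height P H :=
  (forall C, chain_in P C -> C #<= H) /\
  (forall (U : Type) (K : set U), (forall C, chain_in P C -> C #<= K) ->
     H #<= K).

Lemma height_exists P : exists H, is_height P H.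
Proof.
pose ub H := forall C, chain_in P C -> C #<= H.
have ubP : ub P by move=> C [CP _]; exact: subset_card_le.
have [[H Hub] Hmin] := @card_le_least {H | ub H} (exist _ P ubP)
  (fun=> T) (fun B => sval B).
exists H; split=> // U K Kub.
have [//|/card_leP/injfunPex[f _ finj]] := card_le_or H K.
pose K' := [set y | exists x, val (f x) = y].
have KK' : K #= K'.
  apply/card_eqP/bijPex.
  have fK' x : val (f x) \in K' by apply/mem_set; exists x.
  exists (fun x => SigSub (fK' x)); split=> //.
    by move=> x y _ _ [fxy]; apply: finj; rewrite ?in_setT //; exact: val_inj.
  case=> y yK _ /=; have [x xy] := set_mem yK.
  by exists x => //; apply: val_inj.
have K'ub : ub K' by move=> C /Kub CK; rewrite -(card_le_eqr KK').
by rewrite (card_le_eqr KK'); apply: (Hmin (exist _ K' K'ub)).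
Qed.

(* A type whose cardinality is Ht(P); the supremum need not be attained. *)
Definition Ht P : Type := set_type (projT1 (cid (height_exists P))).

Lemma HtP P : is_height P (projT1 (cid (height_exists P))).
Proof. by case: (cid _). Qed.

End Height.

(* Cardinal subtraction of a natural number: a finite cardinal m becomes *)
(* m - n, an infinite cardinal is left unchanged. *)
Definition card_subn (K : Type) (n : nat) : Type :=
  match pselect (finite_set [set: K]) with
  | left Kfin => 'I_(projT1 (cid Kfin) - n)
  | right _ => K
  end.

Lemma card_subn_finite (K : Type) (m n : nat) :
  [set: K] #= `I_m -> [set: card_subn K n] #= `I_(m - n).
Proof.
move=> Km; rewrite /card_subn; case: pselect => [Kfin|[]]; last by exists m.
case: (cid _) => p Kp /=.
have /card_eq_II-> : `I_m #= `I_p by rewrite -(card_eql Km).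
by rewrite card_eq_sym card_II.
Qed.

Lemma card_subn_infinite (K : Type) (n : nat) :
  infinite_set [set: K] -> card_subn K n = K.
Proof. by rewrite /card_subn; case: pselect. Qed.

Section LeftCongruences.
Context (S : semigroupType).

Definition is_monoid := exists e : S, left_id e *%g /\ right_id e *%g.

(* S^1 as a set of left multipliers: None is the adjoined identity, which is *)
(* present only when S is not a monoid. *)
Definition S1 : set (option S) := [set u | u = None -> ~ is_monoid].

Definition S1_mul (u : option S) (x : S) : S :=
  if u is Some s then (s * x)%g else x.

Definition S1_ideal (x : S) : set S := [set S1_mul u x | u in S1].

Definition greenL (x y : S) := S1_ideal x = S1_ideal y.

Record Lclass := MkLclass {
  Lclass_set :> set S;
  LclassP : exists x, Lclass_set = [set y | greenL x y]
}.

Definition equivalence_set (A : Type) (sigma : set (A * A)) :=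
  [/\ forall a, sigma (a, a),
      forall a b, sigma (a, b) -> sigma (b, a) &
      forall a b c, sigma (a, b) -> sigma (b, c) -> sigma (a, c)].

(* LCong and Cong are ordered by the inclusion order of set (_ * _). *)
Definition LCong : set (set (S * S)) :=
  [set sigma | equivalence_set sigma /\
     forall a x y, sigma (x, y) -> sigma ((a * x)%g, (a * y)%g)].

Record lact := MkLact {
  lact_sort :> Type;
  lact_op : S -> lact_sort -> lact_sort;
  lact_opA : forall s s' a, lact_op s (lact_op s' a) = lact_op (s * s')%g a
}.

Definition Cong (A : lact) : set (set (A * A)) :=
  [set sigma | equivalence_set sigma /\
     forall s a b, sigma (a, b) -> sigma (lact_op s a, lact_op s b)].

Lemma S1_idealP x y :
  S1_ideal x y <-> y = x \/ exists s, y = (s * x)%g.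
Proof.
split=> [[[s|] _ <-]|[->|[s ->]]]; first by right; exists s.
- by left.
- have [[e [el er]]|nmon] := pselect is_monoid; last by exists None.
  by exists (Some e) => //=; exact: el.
- by exists (Some s).
Qed.

(* None is the new symbol 0, and insub (s * x) is Some (s * x) if s * x is in *)
(* L and None otherwise. *)
Definition Lbar_op (L : set S) (s : S) (a : option (set_type L)) :
    option (set_type L) :=
  if a is Some x then insub (s * val x)%g else None.

Lemma Lbar_opA (L : Lclass) s s' (a : option (set_type L)) :
  Lbar_op s (Lbar_op s' a) = Lbar_op (s * s')%g a.
Proof.
case: a => [x|//] /=; rewrite -mulgA.
case: insubP => [y _ /= ->//|/negP s'xL] /=.
rewrite insubN//; apply/negP => /set_mem ss'xL; apply: s'xL; apply/mem_set.
have xL := set_valP x; have [z Lz] := LclassP L.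
have LE y : (L : set S) y = greenL z y by rewrite Lz.
rewrite !LE /greenL /= in ss'xL xL *; move: ss'xL; rewrite {}xL => e.
apply/seteqP; split=> w; first rewrite e; move=> /S1_idealP wP.
  apply/S1_idealP; case: wP => [->|[t ->]]; right.
    by exists s.
  by exists (t * s)%g; rewrite !mulgA.
apply/S1_idealP; case: wP => [->|[t ->]]; right; first by exists s'.
by exists (t * s')%g; rewrite mulgA.
Qed.

Definition Lbar (L : Lclass) : lact := MkLact (@Lbar_opA L).

End LeftCongruences.

Arguments LCong S : clear implicits.
Arguments Cong {S} A.

(* Main.v *)
Require Import Defs.
From mathcomp Require Import all_boot all_order all_classical.

Set Implicit Arguments.
Unset Strict Implicit.
Unset Printing Implicit Defensive.

Import Order.TTheory.

Local Open Scope classical_set_scope.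
Local Open Scope card_scope.

(** List the L-classes in an order extending the order of principal left
    ideals [Lclass_rank]. The elements before a class L r form a left ideal I,
    the union of I and L r is again a left ideal, and Lbar (L r) is the Rees
    quotient of the latter by the former, with an isolated zero added when I is
    empty, that is, for the first class. So S is built by k successive
    extensions, and its left congruences are compared with the congruences of
    the k factors.

    For the upper bound, a left congruence restricts to a congruence of each
    Lbar (L r). These restrictions are monotone, and two comparable left
    congruences with the same restrictions are equal [restr_cong_strict]. Hence
    a chain of left congruences, once its minimum is removed, embeds in the
    disjoint union of its k images with their minima removed
    [chain_card_le_sumset]. The restriction to the first class is never total,
    as there is nothing for it to be collapsed into, so the minimum can be sent
    to the total congruence there. This gives a bound by k chains, each of them
    with one element removed [LCong_upper].

    For the lower bound, a congruence of Lbar (L r) lifts to a left congruence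
    of S that collapses everything before L r and nothing after it. The lifts of
    k chains form one chain, and they are distinct if one well chosen congruence
    is removed from each of the k chains [LCong_lower].

    What remains is cardinal arithmetic [Ht_eq_sumset]. Finite heights are
    attained, and the k removed elements account for the subtraction of k. If
    some height is infinite, both sides are infinite and removing elements does
    not matter; then a finite sum of cardinals bounded by an infinite cardinal
    is still bounded by it, because K x nat has the cardinal of K for infinite K
    [card_setX_nat_le]. *)

(** * Cardinals of disjoint unions *)

(** Relations, unlike functions, need no inhabitant of U and can be given by
    cases without choosing anything. *)
Lemma card_le_relP (T U : Type) (A : set T) (B : set U) :
  A #<= B <-> exists R : T -> U -> Prop,
    (forall x, A x -> exists2 y, B y & R x y) /\
    (forall x x' y, A x -> A x' -> R x y -> R x' y -> x = x').
Proof.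
split=> [/card_leP/injfunPex[f _ finj]|[R [Rtot Rinj]]].
  exists (fun x y => exists2 u, val u = x & val (f u) = y); split=> [x Ax|].
    exists (val (f (SigSub (mem_set Ax)))); first exact: set_valP.
    by exists (SigSub (mem_set Ax)).
  move=> x x' y _ _ [u <- <-] [u' <- /val_inj fuu'].
  by rewrite (finj u u') ?in_setT.
apply/card_leP/injfunPex.
have /choice[f fP] : forall x : set_type A, exists y : set_type B,
    R (val x) (val y).
  move=> x; have [y By Rxy] := Rtot _ (set_valP x).
  by exists (SigSub (mem_set By)).
exists f => // x y _ _ fxy; apply: val_inj.
have Ry := fP y; rewrite -fxy in Ry.
by apply: (Rinj (val x) (val y) (val (f x))) => //; exact: set_valP.
Qed.

(** By Zorn's lemma there is a maximal family Z of injective sequences of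
    elements of K with pairwise disjoint ranges. Maximality leaves only
    finitely many elements of K uncovered, and these can be prepended to one of
    the sequences, so K injects into Z x nat; hence K x nat injects into
    Z x nat x nat, and then back into K through a pairing of nat x nat. *)
Lemma card_setX_nat_le (T : Type) (K : set T) :
  infinite_set K -> K `*` [set: nat] #<= K.
Proof.
move=> Kinf.
pose P (Z : set (nat -> T)) :=
  (forall z n, Z z -> K (z n)) /\
  (forall z z' n n', Z z -> Z z' -> z n = z' n' -> z = z' /\ n = n').
have [|Z [[ZK Zinj] Zmax]] := @Zorn_bigcup _ P.
  move=> F FP Ftot; split=> [z n [X FX Xz]|z z' n n' [X FX Xz] [Y FY Yz']].
    exact: (FP _ FX).1.
  have [XY|YX] := Ftot _ _ FX FY.
    by apply: (FP _ FY).2 => //; exact: XY.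
  by apply: (FP _ FX).2 => //; exact: YX.
(* W is what the sequences do not cover: an infinite W would contain one more
   sequence. *)
pose W := [set x | K x /\ forall z n, Z z -> z n <> x].
have [m Wm] : exists m, W #<= `I_m.
  apply/finite_set_leP/finite_setPn => /card_le_relP[R [Rtot Rinj]].
  have /choice[w wP] : forall n, exists y, W y /\ R n y.
    by move=> n; have [//|y Wy Ry] := Rtot n; exists y.
  apply: (Zmax (Z `|` [set w])).
    split; first by move=> z Zz; left.
    move=> /(_ w (or_intror erefl)) Zw.
    exact: (wP 0%N).1.2 _ 0%N Zw erefl.
  split=> [z n [/ZK//|->]|z z' n n' [Zz|->] [Zz'|->]].
  - exact: (wP n).1.1.
  - exact: Zinj.
  - by move=> /((wP n').1.2 _ _ Zz).
  - by move=> /esym /((wP n).1.2 _ _ Zz').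
  - by move=> e; split=> //; apply: (Rinj _ _ (w n)) => //;
      [exact: (wP n).2 | rewrite e; exact: (wP n').2].
have [z0 Zz0] : Z !=set0.
  apply/set0P/eqP => Z0; apply: Kinf; apply/finite_set_leP; exists m.
  apply: card_le_trans Wm; apply: subset_card_le => x Kx; split=> // z n.
  by rewrite Z0.
have /card_le_relP[R [Rtot Rinj]] := Wm.
(* The finitely many elements of W become the first m terms of z0, whose own
   terms are shifted by m; the other sequences are unchanged. *)
have KZ : K `*` [set: nat] #<= Z `*` ([set: nat] `*` [set: nat]).
  apply/card_le_relP; exists (fun a b => a.2 = b.2.2 /\
    (W a.1 /\ b.1 = z0 /\ R a.1 b.2.1 /\ (b.2.1 < m)%N \/
     exists i, a.1 = b.1 i /\
       b.2.1 = if pselect (b.1 = z0) then (m + i)%N else i)).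
  split=> [[x n] [/= Kx _]|[x n] [x' n'] [z [i j]] [/= Kx _] [/= Kx' _]].
    have [Wx|] := pselect (W x).
      have [i im Rxi] := Rtot _ Wx.
      by exists (z0, (i, n)) => //=; split=> //; left.
    move=> /not_andP[//|/existsNP[z /existsNP[i /not_implyP[Zz /contrapT <-]]]].
    exists (z, (if pselect (z = z0) then (m + i)%N else i, n)) => //=.
    by split=> //; right; exists i.
  move=> [-> h] [-> h']; congr (_, _).
  case: h h' => [[Wx [-> [Rx im]]]|[u [-> iE]]].
    case=> [[Wx' [_ [Rx' _]]]|[u' [-> iE]]]; first exact: Rinj Rx Rx'.
    by move: im; rewrite iE; case: pselect => [?|[]//]; rewrite ltnNge leq_addr.
  case=> [[Wx' [zz0 [Rx' im]]]|[u' [-> iE']]].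
    by move: im; rewrite iE; case: pselect => [?|[]//]; rewrite ltnNge leq_addr.
  by move: iE; rewrite iE'; case: pselect => [? /= /addnI|? /=] ->.
apply: card_le_trans KZ _; apply/card_le_relP.
exists (fun a b => b = a.1 (pickle a.2)); split=> [[z p] [/= Zz _]|].
  by exists (z (pickle p)) => //; exact: ZK.
move=> [z p] [z' p'] y [/= Zz _] [/= Zz' _] -> /(Zinj _ _ _ _ Zz Zz')[->].
by move=> /(pcan_inj pickleK) ->.
Qed.

(** Disjoint union of a family of sets, whose cardinal is the cardinal sum. *)
Definition sumset (I : Type) (Q : I -> Type) (A : forall i, set (Q i)) :
  set {i & Q i} := [set p | A (tag p) (tagged p)].

Lemma card_le_sumset (I : Type) (Q Q' : I -> Type) (A : forall i, set (Q i))
    (B : forall i, set (Q' i)) :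
  (forall i, A i #<= B i) -> sumset A #<= sumset B.
Proof.
move=> AB.
have /(_ _)/cid wit i := (@card_le_relP _ _ _ _).1 (AB i).
pose R i := projT1 (wit i); have RP i := projT2 (wit i).
(* Transporting along an equality of indices keeps the values in dependent
   pairs accessible without an injectivity principle for such pairs. *)
apply/card_le_relP; exists (fun p q => exists h : tag q = tag p,
  R (tag p) (tagged p) (ecast i (Q' i) h (tagged q))); split.
  move=> [i x] /= Ax; have [y By Rxy] := (RP i).1 _ Ax.
  by exists (Tagged Q' y) => //; exists erefl.
move=> [i x] [i' x'] [j y] /= Ax Ax' [h Rxy] [h' Rxy'].
case: i / h x Ax Rxy => x Ax Rxy; case: i' / h' x' Ax' Rxy' => x' Ax' Rxy'.
by congr (existT _ j _); exact: (RP j).2 _ _ _ Ax Ax' Rxy Rxy'.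
Qed.

Lemma card_le_sumset_infinite (k : nat) (Q : 'I_k -> Type)
    (A : forall r, set (Q r)) (T : Type) (K : set T) :
  infinite_set K -> (forall r, A r #<= K) -> sumset A #<= K.
Proof.
move=> Kinf AK; apply: card_le_trans (card_setX_nat_le Kinf).
apply: card_le_trans (@card_le_sumset _ Q (fun=> T) A (fun=> K) AK) _.
apply/card_le_relP.
exists (fun (p : {_ : 'I_k & T}) q => q = (tagged p, val (tag p))).
split=> [[r x] /= Kx|[r x] [s y] _ _ _ -> [->] /val_inj->//].
by exists (x, val r).
Qed.

Lemma card_sumset_II (k : nat) (Q : 'I_k -> Type) (A : forall r, set (Q r))
    (n : 'I_k -> nat) :
  (forall r, A r #= `I_(n r)) -> sumset A #= `I_(\sum_r n r).
Proof.
move=> An; have : sumset A #= sumset (fun r => [set: 'I_(n r)]).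
  apply/card_eqPle; split; apply: card_le_sumset => r;
    have /card_eqPle[] := An r;
    by rewrite -?(card_le_eqr card_II) -?(card_le_eql card_II).
move=> /card_eq_trans; apply.
have -> : sumset (fun r => [set: 'I_(n r)]) = [set: {r & 'I_(n r)}].
  by apply/seteqP; split.
have -> : (\sum_r n r)%N = #|{: {r & 'I_(n r)}}|.
  rewrite card_tagged sumnE big_map big_enum /=.
  by apply: eq_bigr => r _; rewrite card_ord.
rewrite (card_eqr card_II); apply/card_eqP/bijPex.
exists (fun x : [set: {r & 'I_(n r)}] => SigSub (in_setT (enum_rank (val x)))).
split=> //.
  by move=> x y _ _ [/enum_rank_inj/val_inj].
move=> y _ /=; exists (SigSub (in_setT (enum_val (val y)))) => //.
by apply: val_inj; rewrite /= enum_valK.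
Qed.

Lemma card_le_setD1 (T U : Type) (A : set T) (B : set U) (a : T) (b : U) :
  B b -> A `\ a #<= B `\ b -> A #<= B.
Proof.
move=> Bb /card_le_relP[R [Rtot Rinj]]; apply/card_le_relP.
exists (fun x y => x = a /\ y = b \/ [/\ x <> a, y <> b & R x y]).
split=> [x Ax|x x' y Ax Ax'].
  have [->|xa] := pselect (x = a); first by exists b => //; left.
  by have [//|y [By yb] Rxy] := Rtot x; exists y => //; right.
move=> [[-> ->]|[xa yb Rxy]] [[-> yb']|[xa' yb' Rxy']] //.
exact: (Rinj x x' y).
Qed.

Lemma II_setD1 n : `I_n.+1 `\ n = `I_n.
Proof.
apply/seteqP; split=> [i /= [] |i /= iln]; last first.
  by split; [exact: ltnW|move=> e; rewrite e ltnn in iln].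
by rewrite ltnS leq_eqVlt => /orP[/eqP|].
Qed.

Lemma card_le_setD1_II (T : Type) (A : set T) (a : T) n :
  A `\ a #<= `I_n -> A #<= `I_n.+1.
Proof.
by move=> An; apply: (@card_le_setD1 _ _ _ _ a n) => //=; rewrite II_setD1.
Qed.

(** If A minus a had more than n.-1 elements, putting a back would give more
    than n elements. *)
Lemma card_setD1_le_II (T : Type) (A : set T) (a : T) n :
  A a -> A #<= `I_n -> A `\ a #<= `I_n.-1.
Proof.
move=> Aa An; have [m Am] : finite_set (A `\ a).
  by apply: finite_setD; apply/finite_set_leP; exists n.
have mA : `I_m.+1 #<= A.
  apply: (@card_le_setD1 _ _ _ _ m a) => //.
  by rewrite II_setD1 (card_le_eqr Am).
rewrite (card_le_eql Am) card_le_II.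
by have := card_le_trans mA An; rewrite card_le_II; case: (n).
Qed.

Lemma card_le_setD1_infinite (T U : Type) (A : set T) (a : T) (K : set U) :
  infinite_set K -> A `\ a #<= K -> A #<= K.
Proof.
move=> Kinf AK; apply: card_le_trans (card_setX_nat_le Kinf).
have [y Ky] := infinite_setN0 Kinf.
apply: (@card_le_setD1 _ _ _ _ a (y, 0)) => //.
apply: card_le_trans AK _; apply/card_le_relP.
exists (fun x q => q = (x, 1)); split=> [x Kx|x x' _ _ _ -> [->]//].
by exists (x, 1).
Qed.

(** * Heights from bounds on chains *)

(** A supremum that is a successor cardinal n.+1 is attained: otherwise n would
    already bound all chains. *)
Lemma finite_height_attained (d : Order.disp_t) (T : porderType d)
    (P H : set T) (n : nat) :
  is_height P H -> H #= `I_n -> exists2 C, chain_in P C & `I_n #<= C.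
Proof.
move=> [Hub Hmin] Hn; apply: contrapT => noC.
have {noC} ltC C : chain_in P C -> ~ (`I_n #<= C).
  by move=> Cc nC; apply: noC; exists C.
case: n => [|n] in Hn ltC *.
  by apply: (ltC set0); [split | rewrite II0].
suff /Hmin : forall C, chain_in P C -> C #<= `I_n.
  by rewrite (card_le_eql Hn) card_le_II ltnn.
move=> C Cc; have Cn : C #<= `I_n.+1 by rewrite -(card_le_eqr Hn); exact: Hub.
have [p Cp] : finite_set C by apply/finite_set_leP; exists n.+1.
have /negP := ltC _ Cc.
by rewrite (card_le_eqr Cp) (card_le_eql Cp) !card_le_II -leqNgt.
Qed.

Lemma card_le_sumset1 (I : Type) (Q : I -> Type) (A : forall i, set (Q i))
    (i : I) : A i #<= sumset A.
Proof.
apply/card_le_relP; exists (fun x q => exists h : tag q = i,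
  ecast i (Q i) h (tagged q) = x); split=> [x Ax|x x' q _ _ [h <-] [h' <-]].
  by exists (existT _ i x) => //; exists erefl.
by rewrite (Prop_irrelevance h h').
Qed.

(** The cardinal arithmetic of the theorem. The first hypothesis bounds chains
    of P by sums of chains of the R r with one point removed from each, the
    second realizes such sums by chains of P. When all heights are finite they
    are attained, and removing a point from each of k nonempty chains subtracts
    exactly k. Otherwise the height of P is infinite: it bounds every chain of
    every R r up to one point, hence bounds each height, hence their finite
    sum. *)
Lemma Ht_eq_sumset (k : nat) (d d' : Order.disp_t) (T : porderType d)
    (Q : 'I_k -> porderType d') (P : set T) (R : forall r, set (Q r)) :
  (forall C, chain_in P C -> exists (D : forall r, set (Q r))
      (b : forall r, Q r), (forall r, chain_in (R r) (D r) /\ D r (b r)) /\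
      C #<= sumset (fun r => D r `\ b r)) ->
  (forall D : forall r, set (Q r), (forall r, chain_in (R r) (D r)) ->
      exists (e : forall r, Q r) C, chain_in P C /\
      sumset (fun r => D r `\ e r) #<= C) ->
  [set: Ht P] #= [set: card_subn {r : 'I_k & Ht (R r)} k].
Proof.
move=> upper lower; rewrite (card_eql (card_setT _)).
have := HtP P; set H := projT1 _ => -[Hub Hmin].
pose G r := projT1 (cid (height_exists (R r))).
have GP r : is_height (R r) (G r) := HtP (R r).
have GT : sumset G #= [set: {r : 'I_k & Ht (R r)}].
  have -> : [set: {r : 'I_k & Ht (R r)}] = sumset (fun r => [set: Ht (R r)]).
    by apply/seteqP; split.
  apply/card_eqPle; split; apply: card_le_sumset => r.
    by rewrite (card_le_eqr (card_setT _)).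
  by rewrite (card_le_eql (card_setT _)).
have chain0 r : chain_in (R r) set0 by split.
have [Gfin|Ginf] := pselect (forall r, finite_set (G r)).
  have /choice[n Gn] r : exists m, G r #= `I_m := Gfin r.
  (* The first hypothesis, applied to the empty chain, yields a nonempty chain
     in each R r. *)
  have n_gt0 r : (0 < n r)%N.
    have [|D [b [DP _]]] := upper set0; first by split.
    have [Dc Db] := DP r; rewrite lt0n; apply/eqP => n0.
    have := (GP r).1 _ Dc; rewrite (card_le_eqr (Gn r)) n0 II0.
    by move=> /card_le0P D0; move: Db; rewrite D0.
  have sumn : (\sum_r (n r).-1 = \sum_r n r - k)%N.
    rewrite -[X in (_ - X)%N]card_ord -sum1_card -sumnB //.
    by apply: eq_bigr => r _; rewrite subn1.
  have /card_subn_finite-/(_ k) sub :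
      [set: {r : 'I_k & Ht (R r)}] #= `I_(\sum_r n r).
    by rewrite -(card_eql GT); exact: card_sumset_II.
  rewrite (card_eqr sub) -sumn; apply/card_eqPle; split.
    apply: Hmin => C /upper[D [b [DP]]] /card_le_trans; apply.
    rewrite -(card_le_eqr (@card_sumset_II _ (fun=> nat) (fun r => `I_(n r).-1)
      (fun r => (n r).-1) (fun=> card_eqxx _))).
    apply: card_le_sumset => r; have [Dc Db] := DP r.
    apply: card_setD1_le_II => //; rewrite -(card_le_eqr (Gn r)).
    exact: (GP r).1.
  have wit r := cid2 (finite_height_attained (GP r) (Gn r)).
  pose D r := s2val (wit r).
  have Dc r : chain_in (R r) (D r) := s2valP (wit r).
  have nD r : `I_(n r) #<= D r := s2valP' (wit r).
  have [e [C [Cc DC]]] := lower D Dc.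
  apply: card_le_trans (Hub _ Cc); apply: card_le_trans DC.
  rewrite -(card_le_eql (@card_sumset_II _ (fun=> nat) (fun r => `I_(n r).-1)
      (fun r => (n r).-1) (fun=> card_eqxx _))).
  apply: card_le_sumset => r; apply: contrapT => /negP nle.
  have [m Dm] : finite_set (D r `\ e r).
    apply: finite_setD; apply: card_le_finite (Gfin r); exact: (GP r).1.
  move: nle; rewrite (card_le_eqr Dm) card_le_II -ltnNge => mn.
  have : D r #<= `I_m.+1.
    by apply: (@card_le_setD1_II _ _ (e r)); rewrite (card_le_eql Dm).
  move=> /(card_le_trans (nD r)); rewrite card_le_II leqNgt.
  by rewrite -[n r]prednK // ltnS mn.
(* The second hypothesis is used with C in coordinate r and the empty chain
   elsewhere. *)
have le_setD1 r C : chain_in (R r) C -> exists e, C `\ e #<= H.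
  move=> Cc; pose D := @dfwith _ (fun s => set (Q s)) (fun=> set0) r C.
  have [|e [C' [C'c DC']]] := lower D.
    by move=> s; rewrite /D; case: dfwithP.
  exists (e r); apply: card_le_trans (Hub _ C'c); apply: card_le_trans DC'.
  have := @card_le_sumset1 _ _ (fun s => D s `\ e s) r.
  by rewrite /D dfwithin.
have Hinf : infinite_set H.
  move=> [m Hm]; apply: Ginf => r; apply/finite_set_leP; exists m.+1.
  apply: (GP r).2 => C /le_setD1[e]; rewrite (card_le_eqr Hm).
  exact: card_le_setD1_II.
rewrite card_subn_infinite; last first.
  rewrite -(eq_finite_set GT) => Gfin; apply: Ginf => r.
  exact: card_le_finite (@card_le_sumset1 _ _ G r) Gfin.
rewrite -(card_eqr GT); apply/card_eqPle; split.
  apply: Hmin => C /upper[D [b [DP]]] /card_le_trans; apply.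
  apply: card_le_sumset => r; apply: card_le_trans (card_le_setD _ _) _.
  by apply: (GP r).1; exact: (DP r).1.
apply: card_le_sumset_infinite => // r; apply: (GP r).2 => C /le_setD1[e].
exact: card_le_setD1_infinite.
Qed.

(** * Chains under jointly strict monotone maps *)

(** A chain C on which monotone maps f 0, ..., f (k-1) are jointly strict embeds
    in the disjoint union of the images, with its minimum c0 and the images of
    c0 left out. Every c is the least among the elements that agree with it
    under all the maps, while only c0 is least among the elements of C. For
    c <> c0 let r be the coordinate at which agreement first makes c least, and
    send c to f r c in the summand r. If x < y both went to the same value in
    the summand r, then some z of C that agrees with y before r would not be
    above y. If x <= z, then f r z lies between f r x and f r y, so z agrees
    with y at r too; if z < x, then x agrees with y up to r. Either way y is
    not least among the elements agreeing with it up to r. *)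
Lemma chain_card_le_sumset (k : nat) (d d' : Order.disp_t) (T : porderType d)
    (Q : 'I_k -> porderType d') (f : forall r, T -> Q r) (C : set T) (c0 : T) :
  total_on C (fun x y => (x <= y)%O) ->
  C c0 -> (forall c, C c -> (c0 <= c)%O) ->
  (forall r x y, C x -> C y -> (x <= y)%O -> (f r x <= f r y)%O) ->
  (forall x y, C x -> C y -> (x <= y)%O -> (forall r, f r x = f r y) ->
    x = y) ->
  C `\ c0 #<= sumset (fun r => (f r @` C) `\ f r c0).
Proof.
move=> Ctot Cc0 c0P fhomo fstrict; apply/card_le_relP.
pose agree (n : nat) c x := forall j : 'I_k, (j < n)%N -> f j x = f j c.
pose least n c := forall x, C x -> agree n c x -> (c <= x)%O.
exists (fun c p => [/\ tagged p = f (tag p) c, ~ least (tag p) c &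
                       least (tag p).+1 c]); split=> [c [Cc cc0]|].
  pose P n := `[< ~ least n c >].
  have P0 : exists n, P n.
    exists 0%N; apply/asboolP => /(_ c0 Cc0) cle; apply: cc0.
    by apply/eqP; rewrite eq_le c0P // cle // => j.
  have Pk n : P n -> (n <= k)%N.
    move=> /asboolP nl; rewrite leqNgt; apply/negP => kn; apply: nl => x Cx xc.
    have [//|xlec] := Ctot _ _ Cc Cx.
    rewrite (fstrict x c) // => r; apply: xc.
    exact: ltn_trans (ltn_ord r) kn.
  case: (ex_maxnP P0 Pk) => n /asboolP nl nmax.
  have lS : least n.+1 c.
    by apply: contrapT => /asboolP/nmax; rewrite ltnn.
  have ltnk : (n < k)%N.
    rewrite ltnNge; apply/negP => kn; apply: nl => x Cx xc.
    by apply: lS => // j _; apply: xc; exact: leq_trans (ltn_ord j) kn.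
  pose r := Ordinal ltnk; exists (existT _ r (f r c)); last by split.
  split=> /=; first by exists c.
  move=> fcc0; apply: nl => x Cx xc.
  have [//|xlec] := Ctot _ _ Cc Cx; apply: lS => // j.
  rewrite ltnS leq_eqVlt => /orP[/eqP jr|]; last exact: xc.
  have {jr} -> : j = r by exact: val_inj.
  by apply/eqP; rewrite eq_le fhomo //= fcc0 fhomo // c0P.
have main x y (r : 'I_k) : C x -> C y -> (x <= y)%O -> f r x = f r y ->
    ~ least r y -> least r.+1 y -> x = y.
  move=> Cx Cy xy fxy ynl yl; apply/eqP; rewrite eq_le xy /=.
  apply: contrapT => nyx; apply: ynl => z Cz zy.
  have [//|lez] := Ctot _ _ Cy Cz.
  have [xz|zx] := Ctot _ _ Cx Cz.
    apply: yl => // j; rewrite ltnS leq_eqVlt => /orP[/eqP jr|]; last exact: zy.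
    have {jr} -> : j = r by exact: val_inj.
    by apply/eqP; rewrite eq_le fhomo //= -fxy fhomo.
  case: nyx; apply: yl => // j; rewrite ltnS leq_eqVlt => /orP[/eqP jr|jr].
    by have -> : j = r by exact: val_inj.
  by apply/eqP; rewrite eq_le fhomo //= -(zy _ jr) fhomo.
move=> x y [r a] [Cx _] [Cy _] /= [-> xnl xl] [fxy ynl yl].
have [xy|yx] := Ctot _ _ Cx Cy; first exact: (main x y r).
by apply/esym/(main y x r).
Qed.

(** * Congruences of one L-class and left congruences *)

Section OneClass.
Context (S : semigroupType).

Definition left_ideal (I : set S) := forall s x, I x -> I (s * x)%g.

Lemma Lclass_green (L : Lclass S) x y :
  (L : set S) x -> ((L : set S) y <-> greenL x y).
Proof.
by have [z ->] := LclassP L => /= zx; rewrite /greenL in zx *; rewrite zx.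
Qed.

Lemma Lclass_neq0 (L : Lclass S) : (L : set S) !=set0.
Proof. by have [z ->] := LclassP L; exists z. Qed.

Lemma Lclass_reach (L : Lclass S) x y : (L : set S) x -> (L : set S) y ->
  y = x \/ exists s, y = (s * x)%g.
Proof.
move=> Lx /(Lclass_green _ Lx) xy; apply/S1_idealP.
by rewrite xy; apply/S1_idealP; left.
Qed.

Lemma Lclass_mul (L : Lclass S) s x :
  (L : set S) x -> S1_ideal x `<=` S1_ideal (s * x)%g ->
  (L : set S) (s * x)%g.
Proof.
move=> Lx sub; apply/(Lclass_green _ Lx); apply/seteqP; split=> // y.
move=> /S1_idealP[->|[t ->]]; apply/S1_idealP; right; first by exists s.
by exists (t * s)%g; rewrite mulgA.
Qed.

Context (I : set S) (L : Lclass S).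
Hypotheses (idI : left_ideal I) (idIL : left_ideal (I `|` L))
  (disjIL : forall x, I x -> ~ (L : set S) x).

(** On I `|` L the projection p collapses the left ideal I to the zero of
    Lbar L, so that Lbar L is the Rees quotient of I `|` L by I; when I is empty
    the zero is not in the image of p. *)
Let p (x : S) : Lbar L := insub x.

Lemma insub_in x (Lx : (L : set S) x) :
  insub x = Some (SigSub (mem_set Lx)) :> Lbar L.
Proof. by rewrite insubT ?mem_set // => ?; congr Some; apply: val_inj. Qed.

Lemma insub_out x : ~ (L : set S) x -> insub x = None :> Lbar L.
Proof. by move=> nLx; rewrite insubN //; apply/negP => /set_mem. Qed.

Lemma insub_mul s x : (I `|` L) x -> p (s * x)%g = lact_op s (p x).
Proof.
move=> [Ix|Lx]; last by rewrite {2}/p (insub_in Lx).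
by rewrite /p !insub_out //; apply: disjIL => //; exact: idI.
Qed.

Lemma insub_surj (a : Lbar L) : I !=set0 \/ a <> None ->
  exists2 x, (I `|` L) x & p x = a.
Proof.
case: a => [x _|[[i Ii]|[]//]].
  by exists (val x); [right; exact: set_valP|exact: valK].
by exists i; [left|apply: insub_out; exact: disjIL].
Qed.

(** All elements of L are multiples of each other, so relating one of them to
    zero relates all of them to zero. *)
Lemma Lbar_Cong_top rho x : Cong (Lbar L) rho -> (L : set S) x ->
  rho (p x, None) -> rho = setT.
Proof.
move=> [[rrefl rsym rtrans] rmul] Lx rx.
suff r0 a : rho (a, None).
  by apply/seteqP; split=> // -[a b] _; apply: rtrans (r0 a) (rsym _ _ (r0 b)).
case: a => [y|]; last exact: rrefl.
have <- : p (val y) = Some y by exact: valK.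
have [->//|[s ->]] := Lclass_reach Lx (set_valP y).
by rewrite insub_mul; [exact: rmul s _ _ rx|right].
Qed.

(** The congruence of the Rees quotient of I `|` L by I, pulled back to
    I `|` L and extended by equality. *)
Definition lift_cong (rho : set (Lbar L * Lbar L)) : set (S * S) :=
  [set xy | xy.1 = xy.2 \/
    [/\ (I `|` L) xy.1, (I `|` L) xy.2 & rho (p xy.1, p xy.2)]].

Lemma lift_cong_LCong rho : Cong (Lbar L) rho -> LCong S (lift_cong rho).
Proof.
move=> [[rrefl rsym rtrans] rmul]; split; first split.
- by move=> x; left.
- move=> x y [/= ->|[/= Ix Iy rxy]]; [by left|right; split=> //=].
  exact: rsym.
- move=> x y z [/= ->//|[/= Ix Iy rxy]] [/= <-|[/= _ Iz ryz]].
    by right.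
  by right; split=> //=; exact: rtrans ryz.
- move=> s x y [/= ->|[/= Ix Iy rxy]]; [by left|right; split=> /=].
  + exact: idIL.
  + exact: idIL.
  + by rewrite !insub_mul //; exact: rmul.
Qed.

Lemma lift_cong_mono rho rho' :
  rho `<=` rho' -> lift_cong rho `<=` lift_cong rho'.
Proof. by move=> sub xy [?|[? ? /sub]]; [left|right]. Qed.

Lemma lift_cong_low rho x y : Cong (Lbar L) rho -> I x -> I y ->
  lift_cong rho (x, y).
Proof.
move=> [[rrefl _ _] _] Ix Iy; right; split; [by left|by left|].
by rewrite /= /p !insub_out; [exact: rrefl|exact: disjIL|exact: disjIL].
Qed.

(** With I empty, lifting forgets whether zero is related to L. Only two
    congruences differ in nothing else, the total one and the one with classes L
    and zero, so it is enough to exclude the first. *)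
Lemma lift_cong_inj rho rho' : Cong (Lbar L) rho -> Cong (Lbar L) rho' ->
  I !=set0 \/ rho <> setT ->
  lift_cong rho `<=` lift_cong rho' -> rho `<=` rho'.
Proof.
move=> Cr Cr' Irho sub [a b] rab.
have [[rrefl rsym rtrans] _] := Cr; have [[rrefl' _ _] _] := Cr'.
have [<-//|ab] := pselect (a = b).
have rtop c : rho (c, None) -> I !=set0 \/ c = None.
  case: c => [x rx|]; last by right.
  left; case: Irho => // []; case.
  apply: (@Lbar_Cong_top _ (val x)) => //; first exact: set_valP.
  by rewrite /p valK.
have [x Ix xa] : exists2 x, (I `|` L) x & p x = a.
  apply: insub_surj; case: a rab ab => [? _ _|r0 nb]; first by right.
  by have [?|/esym//] := rtop b (rsym _ _ r0); left.
have [y Iy yb] : exists2 y, (I `|` L) y & p y = b.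
  apply: insub_surj; case: b rab ab => [? _ _|r0 nb]; first by right.
  by have [?|//] := rtop a r0; left.
have [|/= xy|[]] // := sub (x, y); last by rewrite /= xa yb.
  by right; split=> //=; rewrite xa yb.
by case: ab; rewrite -xa -yb xy.
Qed.

Definition meets_low (sigma : set (S * S)) :=
  exists x y, [/\ (L : set S) x, I y & sigma (x, y)].

(** The congruence induced by sigma on the Rees quotient of I `|` L by I. When
    sigma is a left congruence that relates one element of L to I, it relates
    all of them to I, and the induced congruence is total. *)
Definition restr_cong (sigma : set (S * S)) : set (Lbar L * Lbar L) :=
  [set ab | meets_low sigma \/
    match ab with
    | (Some x, Some y) => sigma (val x, val y)
    | (None, None) => True
    | _ => False
    end].

Lemma restr_cong_Cong sigma : LCong S sigma -> Cong (Lbar L) (restr_cong sigma).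
Proof.
move=> [[srefl ssym strans] smul].
have [low|nlow] := pselect (meets_low sigma).
  rewrite (_ : restr_cong sigma = setT) //.
  by apply/seteqP; split=> // ? _; left.
split; first split.
- by move=> [x|]; right.
- by move=> [x|] [y|] [//|xy]; right => //; exact: ssym.
- move=> [x|] [y|] [z|] [//|xy] [//|yz]; right => //.
  exact: strans yz.
- move=> s [x|] [y|] [//|xy]; right => //=.
  have /(smul s) sxy := xy.
  have IL (z : set_type L) : (I `|` L) (s * val z)%g.
    by apply: idIL; right; exact: set_valP.
  have [Ix|Lx] := IL x; have [Iy|Ly] := IL y.
  + by rewrite !insub_out //; exact: disjIL.
  + by case: nlow; exists (s * val y)%g, (s * val x)%g; split=> //; exact: ssym.
  + by case: nlow; exists (s * val x)%g, (s * val y)%g.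
  + by rewrite (insub_in Lx) (insub_in Ly).
Qed.

Lemma restr_cong_mono sigma tau :
  sigma `<=` tau -> restr_cong sigma `<=` restr_cong tau.
Proof.
move=> sub [[x|] [y|]] [[u [v [Lu Iv /sub uv]]]|xy];
  by [left; exists u, v|right; try exact: sub].
Qed.

(** With I empty, nothing can be related to zero. Joining k chains end to end
    would only lose k - 1 elements; the k-th unit to be subtracted comes from
    here. *)
Lemma restr_cong_neqT sigma : I = set0 -> restr_cong sigma <> setT.
Proof.
move=> I0 sT; have [x Lx] := Lclass_neq0 L.
have : restr_cong sigma (p x, None) by rewrite sT.
by rewrite /p (insub_in Lx) => -[[u [v [_ + _]]]|//]; rewrite I0.
Qed.

Lemma restr_congP sigma x y : (L : set S) x -> (L : set S) y ->
  restr_cong sigma (p x, p y) -> meets_low sigma \/ sigma (x, y).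
Proof.
by move=> Lx Ly; rewrite /p (insub_in Lx) (insub_in Ly) => -[]; [left|right].
Qed.

Lemma restr_cong_low sigma : meets_low sigma <->
  exists x, (L : set S) x /\ restr_cong sigma (p x, None).
Proof.
split=> [h|[x [Lx]]]; last first.
  by rewrite /p (insub_in Lx) => -[].
by have [x Lx] := Lclass_neq0 L; exists x; split=> //; left.
Qed.

Lemma meets_low_all sigma x : LCong S sigma -> meets_low sigma ->
  (L : set S) x -> exists2 i, I i & sigma (x, i).
Proof.
move=> [_ smul] [u [i [Lu Ii ui]]] Lx.
have [->|[s ->]] := Lclass_reach Lu Lx; first by exists i.
by exists (s * i)%g; [exact: idI|exact: smul].
Qed.

End OneClass.

(** * Chains of left congruences *)

Lemma Lclass_inj (S : semigroupType) (L L' : Lclass S) x :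
  (L : set S) x -> (L' : set S) x -> L = L'.
Proof.
move=> Lx L'x; have : (L : set S) = L'.
  by apply/seteqP; split=> y; rewrite (Lclass_green _ Lx) (Lclass_green _ L'x).
case: L L' {Lx L'x} => [A pA] [B pB] /= AB; subst B.
by rewrite (Prop_irrelevance pA pB).
Qed.

(** A linear extension of the order of the L-classes, given by natural numbers
    attached to the classes and to the elements. The main term is the number of
    classes below the given one, which strictly decreases when the class does;
    multiplied by k, it leaves room for the index of the class, which makes the
    numbers of distinct classes distinct. *)
Lemma Lclass_rank (S : semigroupType) (k : nat) (L : 'I_k -> Lclass S) :
  bijective L -> exists (key : 'I_k -> nat) (kappa : S -> nat),
  [/\ injective key, forall r x, (L r : set S) x <-> kappa x = key r,
      forall x, exists r, kappa x = key r &
      forall s x, (kappa (s * x)%g <= kappa x)%N].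
Proof.
move=> [g Lg gL].
have /choice[cl clP] x : exists r, (L r : set S) x.
  pose Lx := @MkLclass S [set y | greenL x y] (ex_intro _ x erefl).
  by exists (g Lx); rewrite gL.
have cl_eq r x : (L r : set S) x -> cl x = r.
  by move=> /(Lclass_inj (clP x))/(can_inj Lg).
pose down x := [set r : 'I_k | `[< exists2 y, (L r : set S) y &
  S1_ideal y `<=` S1_ideal x >]]%SET.
have down_sub s x : down (s * x)%g \subset down x.
  apply/fintype.subsetP => r; rewrite !finset.in_set => /asboolP[y Ly sub].
  apply/asboolP; exists y => // z /sub /S1_idealP[->|[t ->]];
    apply/S1_idealP; right.
    by exists s.
  by exists (t * s)%g; rewrite mulgA.
have down_eq s x : down (s * x)%g = down x -> cl (s * x)%g = cl x.
  move=> dsx; apply: cl_eq; apply: Lclass_mul => // z.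
  have : cl x \in down x by rewrite finset.in_set; apply/asboolP; exists x.
  rewrite -dsx finset.in_set => /asboolP[y Ly sub].
  by rewrite ((Lclass_green _ (clP x)).1 Ly); exact: sub.
have down_cl x y : cl x = cl y -> down x = down y.
  move=> xy; have yx : greenL x y by apply/(Lclass_green _ (clP x)); rewrite xy.
  by apply/setP => r; rewrite !finset.in_set yx.
pose kappa x := (#|down x| * k + cl x)%N.
have kappa_cl x y : kappa x = kappa y -> cl x = cl y.
  move=> /(congr1 (modn^~ k)); rewrite !modnMDl !modn_small //.
  exact: val_inj.
have cl_kappa x y : cl x = cl y -> kappa x = kappa y.
  by move=> xy; rewrite /kappa (down_cl _ _ xy) xy.
have /choice[rep repP] r := Lclass_neq0 (L r).
have cl_rep r : cl (rep r) = r by exact: cl_eq.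
exists (kappa \o rep), kappa; split=> [r s /kappa_cl|r x|x|s x].
- by rewrite !cl_rep.
- split=> [/cl_eq xr|/kappa_cl]; first by apply: cl_kappa; rewrite cl_rep.
  by rewrite cl_rep => <-.
- by exists (cl x); apply: cl_kappa; rewrite cl_rep.
- have [/down_eq/cl_kappa->//|dd] := eqVneq (down (s * x)%g) (down x).
  have lt : (#|down (s * x)%g| < #|down x|)%N.
    by apply: proper_card; rewrite finset.properEneq dd down_sub.
  apply: (@leq_trans (#|down (s * x)%g|.+1 * k)).
    by rewrite /kappa mulSn [leqRHS]addnC leq_add2l ltnW.
  by apply: leq_trans (leq_addr _ _); rewrite leq_mul2r lt orbT.
Qed.

Lemma LCong_diag (S : semigroupType) : LCong S [set xy | xy.1 = xy.2].
Proof.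
split; first split.
- by [].
- by move=> x y /= ->.
- by move=> x y z /= -> ->.
- by move=> s x y /= ->.
Qed.

Lemma diag_min (S : semigroupType) (sigma : set (S * S)) :
  LCong S sigma -> [set xy | xy.1 = xy.2] `<=` sigma.
Proof. by move=> [[srefl _ _] _] [x y] /= ->; exact: srefl. Qed.

Section Ranked.
Context (S : semigroupType) (k : nat) (L : 'I_k -> Lclass S)
  (key : 'I_k -> nat) (kappa : S -> nat).
Hypotheses (key_inj : injective key)
  (kappaL : forall r x, (L r : set S) x <-> kappa x = key r)
  (kappa_ex : forall x, exists r, kappa x = key r)
  (kappaM : forall s x, (kappa (s * x)%g <= kappa x)%N).

Definition below r := [set x | (kappa x < key r)%N].

Lemma below_ideal r : left_ideal (below r).
Proof. by move=> s x; exact: leq_ltn_trans. Qed.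

Lemma belowUE r x : (below r `|` L r) x <-> (kappa x <= key r)%N.
Proof.
rewrite leq_eqVlt; split=> [[|/kappaL->]|/orP[/eqP/kappaL|]].
- by rewrite /below /= => ->; rewrite orbT.
- by rewrite eqxx.
- by right.
- by left.
Qed.

Lemma belowU_ideal r : left_ideal (below r `|` L r).
Proof. by move=> s x /belowUE xr; apply/belowUE; exact: leq_trans xr. Qed.

Lemma below_disj r x : below r x -> ~ (L r : set S) x.
Proof. by move=> + /kappaL e; rewrite /below /= e ltnn. Qed.

Let restr r := @restr_cong S (below r) (L r).
Let lift r := @lift_cong S (below r) (L r).
Arguments restr : clear implicits.
Arguments lift : clear implicits.

(** Suppose that x and y are related by tau, and let r be the later of their
    classes. If both lie in L r and sigma does not relate L r to what is below,
    then the restrictions to L r decide. Otherwise sigma, having the same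
    restriction as tau, relates x and y to elements i and j of earlier classes
    (possibly j = y); as sigma is contained in tau, tau relates i and j, so by
    induction sigma does. *)
Lemma restr_cong_strict sigma tau : LCong S sigma -> LCong S tau ->
  sigma `<=` tau -> (forall r, restr r sigma = restr r tau) -> sigma = tau.
Proof.
move=> Cs Ct st restrE; apply/seteqP; split=> // -[x y].
have [[srefl ssym strans] smul] := Cs; have [[trefl tsym ttrans] _] := Ct.
have [n] := ubnP (maxn (kappa x) (kappa y)).
elim: n x y => // n IH x y; rewrite ltnS.
wlog: x y / (kappa y <= kappa x)%N => [wl|yx].
  have /orP[yx|xy] := leq_total (kappa y) (kappa x); first exact: wl.
  by move=> xyn /tsym txy; apply: ssym; apply: wl => //; rewrite maxnC.
rewrite (maxn_idPl yx) => xn txy.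
have [r xr] := kappa_ex x; have Lx : (L r : set S) x by apply/kappaL.
have low_case : meets_low (below r) (L r) sigma -> sigma (x, y).
  move=> low; have all := meets_low_all (@below_ideal r) Cs low.
  have [i Ii xi] := all _ Lx.
  have [j Ij yj] : exists2 j, below r j & sigma (y, j).
    have [yr|/(all y)//] : below r y \/ (L r : set S) y.
      by apply/belowUE; rewrite -xr.
    by exists y.
  apply: (strans _ _ _ xi); apply: (strans _ j); last exact: ssym.
  apply: IH.
    rewrite gtn_max; rewrite /below /= -xr in Ii Ij.
    by rewrite !(leq_trans _ xn).
  apply: (ttrans _ x); first exact/tsym/st.
  by apply: (ttrans _ _ _ txy); exact: st.
have [xy|yltx] := eqVneq (kappa y) (kappa x).
  have Ly : (L r : set S) y by apply/kappaL; rewrite xy.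
  have /(restr_congP Lx Ly)[//|//] : restr r sigma (insub x, insub y).
  by rewrite restrE /restr /= (insub_in Lx) (insub_in Ly); right.
apply: low_case; apply/restr_cong_low; exists x; split=> //.
rewrite -/(restr r) restrE; left; exists x, y; split=> //.
by rewrite /below /= -xr ltn_neqAle yltx.
Qed.

(** Adding the equality relation to C provides a minimum, so C minus this
    minimum embeds by [chain_card_le_sumset]. The minimum itself can go to the
    total congruence in the summand of the first class, which no restriction
    reaches. *)
Lemma LCong_upper (hk : (1 <= k)%N) (C : set (set (S * S))) :
  chain_in (LCong S) C -> exists
    (D : forall r, set (set (Lbar (L r) * Lbar (L r)))) b,
    (forall r, chain_in (Cong (Lbar (L r))) (D r) /\ D r (b r)) /\
    C #<= sumset (fun r => D r `\ b r).
Proof.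
move=> [CL Ctot].
pose diag : set (S * S) := [set xy | xy.1 = xy.2].
have dLC : LCong S diag := LCong_diag S.
have dmin sigma : LCong S sigma -> diag `<=` sigma := @diag_min S sigma.
pose C0 := C `|` [set diag].
have C0L : C0 `<=` LCong S by move=> s [/CL|->].
have C0tot : total_on C0 (fun x y => (x <= y)%O).
  move=> s t [Cs|->] [Ct|->]; first exact: Ctot.
  - by right; rewrite subsetEset; apply: dmin; exact: CL.
  - by left; rewrite subsetEset; apply: dmin; exact: CL.
  - by left.
pose D r := (restr r @` C0) `|` [set setT].
have restr_mono r s t : (s <= t)%O -> (restr r s <= restr r t)%O.
  by rewrite !subsetEset; exact: restr_cong_mono.
have C0d : C0 diag by right.
exists D, (fun r => restr r diag); split=> [r|].
  split; last by left; exists diag.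
  split=> [_ [[s Cs <-]|->//]|].
    apply: restr_cong_Cong; last exact: C0L.
    - exact: belowU_ideal.
    - exact: below_disj.
  move=> _ _ [[s Cs <-]|->] [[t Ct <-]|->]; rewrite ?subsetEset.
  - by have [st|ts] := C0tot _ _ Cs Ct; [left|right];
      rewrite -subsetEset restr_mono.
  - by left.
  - by right.
  - by left.
case: (@arg_minnP _ (Ordinal hk) predT key isT) => r0 _ r0min.
have I0 : below r0 = set0.
  apply/seteqP; split=> // x; rewrite /below /=.
  by have [r ->] := kappa_ex x; rewrite ltnNge r0min.
have restr_neqT s : restr r0 s <> setT by exact: restr_cong_neqT.
apply: card_le_trans (subset_card_le (_ : C `<=` C0)) _.
  by move=> s; left.
apply: (@card_le_setD1 _ _ _ _ diag
  (existT _ r0 (setT : set (Lbar (L r0) * _)))).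
  by split=> [|e] /=; [right|exact: (restr_neqT diag)].
have le : C0 `\ diag #<= sumset (fun r => (restr r @` C0) `\ restr r diag).
  apply: (@chain_card_le_sumset k _ _ _
    (fun r => set (Lbar (L r) * Lbar (L r))) restr) => //.
  - by move=> s Cs; rewrite subsetEset; apply: dmin; exact: C0L.
  - by move=> r s t _ _; exact: restr_mono.
  - move=> s t Cs Ct; rewrite subsetEset => st.
    by apply: restr_cong_strict => //; exact: C0L.
apply: card_le_trans le _; apply: subset_card_le => q [[s Cs sq] nd]; split.
  by split=> //; left; exists s.
by move=> e; move: sq; rewrite e; exact: restr_neqT.
Qed.

(** The lifts of congruences of one class lie below those of any later class,
    so together they form a chain. A lift determines the congruence that it
    comes from once one congruence per class is discarded: the equality
    relation, whose lift is also that of the total congruence of the previous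
    class, and for the first class, which has no predecessor, the total
    congruence. *)
Lemma LCong_lower (D : forall r, set (set (Lbar (L r) * Lbar (L r)))) :
  (forall r, chain_in (Cong (Lbar (L r))) (D r)) -> exists
    (e : forall r, set (Lbar (L r) * Lbar (L r))) C,
    chain_in (LCong S) C /\ sumset (fun r => D r `\ e r) #<= C.
Proof.
move=> Dc.
pose e r : set (Lbar (L r) * Lbar (L r)) :=
  if pselect (below r = set0) then setT else [set ab | ab.1 = ab.2].
pose C := [set s | exists r rho, D r rho /\ s = lift r rho].
exists e, C.
have lift_LCong r rho : D r rho -> LCong S (lift r rho).
  move=> /((Dc r).1) Cr; apply: lift_cong_LCong => //.
  - exact: below_ideal.
  - exact: belowU_ideal.
  - exact: below_disj.
have lift_lt r r' rho rho' : D r' rho' -> (key r < key r')%N ->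
    lift r rho `<=` lift r' rho'.
  move=> Dr rr' [x y] [/= ->|[/= /belowUE xr /belowUE yr _]]; first by left.
  apply: lift_cong_low; first exact: below_disj.
  - exact: (Dc r').1.
  - exact: leq_ltn_trans xr rr'.
  - exact: leq_ltn_trans yr rr'.
split; first split.
- by move=> _ [r [rho [Dr ->]]]; exact: lift_LCong.
- move=> _ _ [r [rho [Dr ->]]] [r' [rho' [Dr' ->]]]; rewrite !subsetEset.
  have [lt|lt|/key_inj rr'] := ltngtP (key r) (key r').
  + by left; exact: lift_lt.
  + by right; exact: lift_lt.
  subst r'; have [] := (Dc r).2 _ _ Dr Dr'; rewrite subsetEset => sub.
  + by left; exact: lift_cong_mono.
  + by right; exact: lift_cong_mono.
have lift_neq r r' rho rho' : (key r < key r')%N -> D r' rho' -> rho' <> e r' ->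
    lift r rho <> lift r' rho'.
  move=> rr' Dr' re liftE.
  have [[rrefl rsym rtrans] _] := (Dc r').1 _ Dr'.
  have [z Lz] := Lclass_neq0 (L r).
  have zr' : below r' z by rewrite /below /= ((kappaL r z).1 Lz).
  apply: re; rewrite /e; case: pselect => [I0|?]; first by rewrite I0 in zr'.
  apply/seteqP; split=> [[a b] rab|[a b] /= ->]; last exact: rrefl.
  have surj (c : Lbar (L r')) : exists2 x, (below r' `|` L r') x & insub x = c.
    by apply: insub_surj; [exact: below_disj|left; exists z].
  have [x Ix xa] := surj a; have [y Iy yb] := surj b.
  have : lift r' rho' (x, y) by right; split=> //=; rewrite xa yb.
  rewrite -liftE => -[/= xy|[/= /belowUE xr /belowUE yr _]].
    by rewrite -xa -yb xy.
  have out u : (kappa u <= key r)%N -> ~ (L r' : set S) u.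
    by move=> ur; apply: below_disj; exact: leq_ltn_trans ur rr'.
  by rewrite -xa -yb !insub_out //; exact: out.
apply/card_le_relP; exists (fun p s => s = lift (tag p) (tagged p)).
split=> [[r rho] [/= Dr _]|[r rho] [r' rho'] s [/= Dr re] [/= Dr' re'] ->].
  by exists (lift r rho) => //; exists r, rho.
move=> liftE; have [lt|lt|/key_inj rr'] := ltngtP (key r) (key r').
- by case: (lift_neq _ _ rho rho' lt Dr' re' liftE).
- by case: (lift_neq _ _ rho' rho lt Dr re (esym liftE)).
subst r'; congr existT.
have low rho1 : rho1 <> e r -> below r !=set0 \/ rho1 <> setT.
  by rewrite /e; case: pselect => [?|nI0] ?; [right|left; exact/set0P/eqP].
have lift_inj := lift_cong_inj (@below_ideal r) (@below_disj r).
move: liftE; rewrite /lift /= => liftE; apply/seteqP; split; apply: lift_inj.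
- exact: (Dc r).1.
- exact: (Dc r).1.
- exact: low.
- by rewrite liftE.
- exact: (Dc r).1.
- exact: (Dc r).1.
- exact: low.
- by rewrite liftE.
Qed.

End Ranked.

Theorem theorem6p1 (S : semigroupType) (k : nat) (hk : (1 <= k)%N)
    (L : 'I_k -> Lclass S) (hL : bijective L) :
  [set: Ht (LCong S)]
    #= [set: card_subn {r : 'I_k & Ht (Cong (Lbar (L r)))} k].
Proof.
have [key [kappa [key_inj kappaL kappa_ex kappaM]]] := Lclass_rank hL.
apply: (@Ht_eq_sumset k _ _ _ (fun r => set (Lbar (L r) * Lbar (L r)))).
  exact: (LCong_upper kappaL kappa_ex kappaM hk).
exact: (LCong_lower key_inj kappaL kappaM).
Qed.
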